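(* For all $p_1,p_2\in(0,1)$, each of the following four inequalities holds if and only if $p_1+p_2>1$: (a) $\mathrm{avg}(p_1,p_2)>1/2$; (b) $\mathrm{geo}(p_1,p_2)>1/2$; (c) $\mathrm{upco}(p_1,p_2)>1/2$; (d) the signed strength output of the MYCIN combination of $p_1,p_2$ is positive, i.e. $\mathrm{combine}(2p_1-1,\,2p_2-1)>0$ (equivalently, the confidence output $(1+\mathrm{combine}(2p_1-1,2p_2-1))/2$ exceeds $1/2$). The same holds with $>$ replaced throughout (in the four inequalities and in $p_1+p_2>1$) by $<$, and with $>$ replaced throughout by $=$.
   Context: For $p_1,p_2\in(0,1)$ define $$\mathrm{avg}(p_1,p_2)=\frac{p_1+p_2}{2},\qquad \mathrm{upco}(p_1,p_2)=\frac{p_1p_2}{p_1p_2+(1-p_1)(1-p_2)},$$ $$\mathrm{geo}(p_1,p_2)=\frac{(p_1p_2)^{1/2}}{(p_1p_2)^{1/2}+\bigl((1-p_1)(1-p_2)\bigr)^{1/2}}.$$ A confidence $c\in(0,1)$ is mapped to the signed strength $s=2c-1\in(-1,1)$, and a signed strength $z$ is mapped back to the confidence $(1+z)/2$. The (revised) MYCIN combination of signed strengths $x,y\in(-1,1)$ is $$\mathrm{combine}(x,y)=\begin{cases} x+y-xy & \text{if } x\ge 0 \text{ and } y\ge 0,\\ x+y+xy & \text{if } x\le 0\text{ and } y\le 0,\\ \dfrac{x+y}{1-\min(|x|,|y|)} & \text{if } x,y \text{ have strictly opposite signs.}\end{cases}$$ (If one of the strengths is $0$, every branch returns the other strength.)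 The MYCIN combination of $p_1,p_2$ is obtained by applying $\mathrm{combine}$ to the strengths $2p_1-1$ and $2p_2-1$. *)

(* Defs.v *)
From mathcomp Require Import all_boot all_order all_algebra.
From mathcomp Require Import reals.

Set Implicit Arguments.
Unset Strict Implicit.
Unset Printing Implicit Defensive.

Import Order.TTheory GRing.Theory Num.Theory.
Local Open Scope ring_scope.

Definition avg (R : realType) (p1 p2 : R) : R := (p1 + p2) / 2.

Definition upco (R : realType) (p1 p2 : R) : R :=
  p1 * p2 / (p1 * p2 + (1 - p1) * (1 - p2)).

Definition geo (R : realType) (p1 p2 : R) : R :=
  Num.sqrt (p1 * p2) /
    (Num.sqrt (p1 * p2) + Num.sqrt ((1 - p1) * (1 - p2))).

Definition strength (R : realType) (c : R) : R := 2 * c - 1.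

Definition confidence (R : realType) (z : R) : R := (1 + z) / 2.

(* The revised MYCIN combination of signed strengths in ]-1, 1[. The last
   branch is reached exactly when x and y have strictly opposite signs. *)
Definition combine (R : realType) (x y : R) : R :=
  if (0 <= x) && (0 <= y) then x + y - x * y
  else if (x <= 0) && (y <= 0) then x + y + x * y
  else (x + y) / (1 - Num.min `|x| `|y|).

Definition mycin_strength (R : realType) (p1 p2 : R) : R :=
  combine (strength p1) (strength p2).

Definition mycin_confidence (R : realType) (p1 p2 : R) : R :=
  confidence (mycin_strength p1 p2).

(* Main.v *)
(* Each of the five quantities, minus its threshold, has the sign of p1 + p2 - 1.
   For upco and geo this rests on p1 p2 - (1 - p1) (1 - p2) = p1 + p2 - 1 and on
   a / (a + b) - 1 / 2 having the sign of a - b; for MYCIN, combine x y has the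
   sign of x + y, in each of the three branches. *)

Require Import Defs.
From mathcomp Require Import all_boot all_order all_algebra.
From mathcomp Require Import reals.
From mathcomp Require Import ring lra.

Import Order.TTheory GRing.Theory Num.Theory.
Local Open Scope ring_scope.

(** The sign of a difference decides all three comparisons at once, so a single sign computation per
    quantity serves the cases [>], [<] and [=] together. *)
Lemma sgr_sub_iff {R : realDomainType} {a b c d : R} :
  Num.sg (a - b) = Num.sg (c - d) ->
  [/\ a > b <-> c > d, a < b <-> c < d & a = b <-> c = d].
Proof.
move=> h; split.
- by rewrite -subr_gt0 -sgr_gt0 h sgr_gt0 subr_gt0.
- by rewrite -subr_lt0 -sgr_lt0 h sgr_lt0 subr_lt0.
- have E : (a == b) = (c == d).
    by rewrite -subr_eq0 -sgr_eq0 h sgr_eq0 subr_eq0.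
  by split=> /eqP; [rewrite E | rewrite -E] => /eqP.
Qed.

Lemma sgr_ratio_sub_half {R : realFieldType} (a b : R) :
  0 < a -> 0 < b -> Num.sg (a / (a + b) - 1 / 2) = Num.sg (a - b).
Proof.
move=> a0 b0; have ab0 : 0 < a + b by exact: addr_gt0.
have -> : a / (a + b) - 1 / 2 = (2 * (a + b))^-1 * (a - b).
  by field; rewrite gt_eqF.
by rewrite sgrM gtr0_sg ?mul1r // invr_gt0 mulr_gt0.
Qed.

(** Writing a and b as squares of their roots factors a - b as (sqrt a - sqrt b) (sqrt a + sqrt b),
    whose second factor is positive. *)
Lemma sgr_sqrt_sub {R : rcfType} (a b : R) :
  0 < a -> 0 < b -> Num.sg (Num.sqrt a - Num.sqrt b) = Num.sg (a - b).
Proof.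
move=> a0 b0.
rewrite -{2}(sqr_sqrtr (ltW a0)) -{2}(sqr_sqrtr (ltW b0)) subr_sqr sgrM.
by rewrite [Num.sg (_ + Num.sqrt _)]gtr0_sg ?mulr1 // addr_gt0 ?sqrtr_gt0.
Qed.

(** With equal signs the product term cannot flip the sign: x + y - x y = x + y (1 - x) and x + y +
    x y = x + y (1 + x), where 1 - x and 1 + x are positive. *)
Lemma sgr_combine {R : realType} (x y : R) :
  -1 < x < 1 -> -1 < y < 1 -> Num.sg (combine x y) = Num.sg (x + y).
Proof.
move=> /andP[xN1 x1] /andP[yN1 y1]; rewrite /combine.
case: ifP => [/andP[x0 y0]|_].
  (* A zero sum of nonnegative terms forces both to vanish, and the product with them; otherwise
     both signs are 1. *)
  have [xy0|xy0] := eqVneq (x + y) 0.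
    have -> : x = 0 by lra.
    by rewrite mul0r subr0.
  have xy_gt0 : 0 < x + y by rewrite lt0r xy0 addr_ge0.
  by rewrite !gtr0_sg //; nra.
case: ifP => [/andP[x0 y0]|_].
  have [xy0|xy0] := eqVneq (x + y) 0.
    have -> : x = 0 by lra.
    by rewrite mul0r addr0.
  have xy_lt0 : x + y < 0 by rewrite lt_neqAle xy0; lra.
  by rewrite !ltr0_sg //; nra.
(* The denominator is positive because the minimum is at most |x| < 1. *)
rewrite sgrM [Num.sg _^-1]gtr0_sg ?mulr1 // invr_gt0 subr_gt0 gt_min.
by rewrite ltr_norml xN1 x1.
Qed.

Theorem proposition1 (R : realType) (p1 p2 : R)
    (hp1 : 0 < p1 < 1) (hp2 : 0 < p2 < 1) :
  [/\ [/\ avg p1 p2 > 1 / 2 <-> p1 + p2 > 1,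
          geo p1 p2 > 1 / 2 <-> p1 + p2 > 1,
          upco p1 p2 > 1 / 2 <-> p1 + p2 > 1,
          mycin_strength p1 p2 > 0 <-> p1 + p2 > 1 &
          mycin_confidence p1 p2 > 1 / 2 <-> p1 + p2 > 1],
      [/\ avg p1 p2 < 1 / 2 <-> p1 + p2 < 1,
          geo p1 p2 < 1 / 2 <-> p1 + p2 < 1,
          upco p1 p2 < 1 / 2 <-> p1 + p2 < 1,
          mycin_strength p1 p2 < 0 <-> p1 + p2 < 1 &
          mycin_confidence p1 p2 < 1 / 2 <-> p1 + p2 < 1] &
      [/\ avg p1 p2 = 1 / 2 <-> p1 + p2 = 1,
          geo p1 p2 = 1 / 2 <-> p1 + p2 = 1,
          upco p1 p2 = 1 / 2 <-> p1 + p2 = 1,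
          mycin_strength p1 p2 = 0 <-> p1 + p2 = 1 &
          mycin_confidence p1 p2 = 1 / 2 <-> p1 + p2 = 1]].
Proof.
have /andP[p1_gt0 p1_lt1] := hp1; have /andP[p2_gt0 p2_lt1] := hp2.
have u0 : 0 < p1 * p2 by exact: mulr_gt0.
have v0 : 0 < (1 - p1) * (1 - p2) by rewrite mulr_gt0 ?subr_gt0.
have uvE : p1 * p2 - (1 - p1) * (1 - p2) = p1 + p2 - 1 by ring.
have half (z : R) : Num.sg (z / 2) = Num.sg z.
  by rewrite sgrM [Num.sg 2^-1]gtr0_sg ?mulr1 // invr_gt0.
have /sgr_sub_iff[a1 a2 a3] : Num.sg (avg p1 p2 - 1 / 2) = Num.sg (p1 + p2 - 1).
  by rewrite /avg -mulrBl half.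
have /sgr_sub_iff[g1 g2 g3] : Num.sg (geo p1 p2 - 1 / 2) = Num.sg (p1 + p2 - 1).
  (* Here the ratio has a and b equal to the two square roots, which are then stripped without
     changing the sign. *)
  by rewrite /geo sgr_ratio_sub_half ?sqrtr_gt0 // sgr_sqrt_sub // uvE.
have /sgr_sub_iff[u1 u2 u3] :
    Num.sg (upco p1 p2 - 1 / 2) = Num.sg (p1 + p2 - 1).
  by rewrite /upco sgr_ratio_sub_half // uvE.
have mE : Num.sg (mycin_strength p1 p2) = Num.sg (p1 + p2 - 1).
  rewrite /mycin_strength sgr_combine; last 2 first.
  - by rewrite /strength; lra.
  - by rewrite /strength; lra.
  (* The two strengths add up to 2 (p1 + p2 - 1); halving removes the factor 2. *)
  by rewrite -[LHS]half /strength; congr Num.sg; field.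
have /sgr_sub_iff[m1 m2 m3] :
    Num.sg (mycin_strength p1 p2 - 0) = Num.sg (p1 + p2 - 1).
  by rewrite subr0.
have /sgr_sub_iff[c1 c2 c3] :
    Num.sg (mycin_confidence p1 p2 - 1 / 2) = Num.sg (p1 + p2 - 1).
  by rewrite /mycin_confidence /confidence -mulrBl half [1 + _]addrC addrK mE.
by split; split.
Qed.
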